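(* Let $A_n(x,y)$ be the bivariate Eulerian polynomials and $C_n(x,y)$ the bivariate second-order Eulerian polynomials. Then for $n\ge1$, $$C_n(x,y)=\sum_{T\in\mathrm{SYT}(n)}\left(\prod_{i=1}^n\sigma_i(T)\,A_i(x,y)^{w_i(T)}\right)y^{n+1-\ell(\lambda(T))}.$$
   Context: $A_n(x,y)=\sum_{\pi\in\mathfrak S_n}x^{\mathrm{des}(\pi)+1}y^{n-\mathrm{des}(\pi)}$, where $\mathfrak S_n$ is the symmetric group on $[n]$ and $\mathrm{des}(\pi)=\#\{i\in[n-1]:\pi(i)>\pi(i+1)\}$. A Stirling permutation of order $n$ is a permutation $\sigma=\sigma_1\cdots\sigma_{2n}$ of the multiset $\{1^2,2^2,\dots,n^2\}$ such that for each $i$ all entries between the two occurrences of $i$ are at least $i$; $\mathcal Q_n$ is the set of these. $C_n(x,y)=\sum_{\sigma\in\mathcal Q_n}x^{\mathrm{des}(\sigma)}y^{2n+1-\mathrm{des}(\sigma)}$ with $\mathrm{des}(\sigma)=\#\{i\in[2n]:\sigma_i>\sigma_{i+1}\}$, $\sigma_{2n+1}=0$. A standard Young tableau of size $n$ is a filling of the Ferrers diagram of a partition $\lambda\vdash n$ (French convention: left-justified rows numbered from bottom to top, $\lambda_i$ boxes in row $i$) with $1,\dots,n$, each used exactly once, increasing from left to right in rows and from bottom to top in columns; $\mathrm{SYT}(n)$ is the set of all of them, over all $\lambda\vdash n$. For $T\in\mathrm{SYT}(n)$, $\ell(\lambda(T))$ is the number of rows of $T$, $w_i(T)$ is the number of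 rows of $T$ with exactly $i$ boxes, $T_i$ is the tableau obtained from $T$ by deleting the entries $i+1,\dots,n$, and $\mathrm{col}_k(T_i)$ is the number of boxes in the $k$-th column of $T_i$. The box sorting index of $i$ is $$\sigma_i(T)=\begin{cases} i-\mathrm{col}_1(T_i)+1, & \text{if } i \text{ is in the first column of } T,\\ \mathrm{col}_k(T_i)-\mathrm{col}_{k+1}(T_i)+1, & \text{if } i \text{ is in the } (k+1)\text{-th column of } T,\ k\ge1.\end{cases}$$ *)

(* Defs.v *)
From mathcomp Require Import all_boot all_order all_fingroup all_algebra.
From mathcomp Require Import mpoly.

Set Implicit Arguments.
Unset Strict Implicit.
Unset Printing Implicit Defensive.

Import GRing.Theory.
Local Open Scope ring_scope.

Definition xvar : {mpoly int[2]} := 'X_ord0.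
Definition yvar : {mpoly int[2]} := 'X_ord_max.

Section Words.
Local Open Scope nat_scope.

Definition des (w : seq nat) : nat :=
  \sum_(0 <= i < (size w).-1) (nth 0 w i.+1 < nth 0 w i).

Definition perm_word (n : nat) (s : 'S_n) : seq nat :=
  [seq (s i).+1 | i <- enum 'I_n].

(* Letters live in {0, ..., n}; the multiset condition excludes the letter 0. *)
Definition stirling_perms (n : nat) : {set (2 * n).-tuple 'I_n.+1} :=
  [set t : (2 * n).-tuple 'I_n.+1 |
         perm_eq [seq val a | a <- t] (iota 1 n ++ iota 1 n)
         & [forall a : 'I_(2 * n), forall b : 'I_(2 * n), forall c : 'I_(2 * n),
              [&& a < b, b < c & tnth t a == tnth t c]
              ==> (tnth t a <= tnth t b)]].

Definition des_stirling (n : nat) (t : (2 * n).-tuple 'I_n.+1) : nat :=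
  des (rcons [seq val a | a <- t] 0).

End Words.

Definition eulerian (n : nat) : {mpoly int[2]} :=
  \sum_(s : 'S_n) xvar ^+ (des (perm_word s)).+1
                  * yvar ^+ (n - des (perm_word s)).

Definition eulerian2 (n : nat) : {mpoly int[2]} :=
  \sum_(t in stirling_perms n)
     xvar ^+ des_stirling t * yvar ^+ ((2 * n).+1 - des_stirling t).

Section Tableaux.
Local Open Scope nat_scope.

(* A tableau is the list of its rows, from bottom to top (French convention);
   rows and columns of the Ferrers diagram are numbered from 1. *)
Implicit Type T : seq (seq nat).

Definition column T (k : nat) : seq nat :=
  [seq nth 0 r k.-1 | r <- T & k <= size r].

Definition col T (k : nat) : nat := size (column T k).

Definition is_syt (n : nat) T : bool :=
  [&& sorted geq (shape T), 0 \notin shape T,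
      perm_eq (flatten T) (iota 1 n),
      all (sorted ltn) T
    & all (fun k => sorted ltn (column T k)) (iota 1 n)].

Definition restrict T (i : nat) : seq (seq nat) :=
  [seq r <- [seq [seq a <- r | a <= i] | r <- T] | r != [::]].

Definition row_of T (i : nat) : seq nat :=
  nth [::] T (find (fun r => i \in r) T).

Definition col_of T (i : nat) : nat := (index i (row_of T i)).+1.

(* On standard tableaux no subtraction below is truncated: T_i has i boxes and
   its column lengths are nonincreasing. *)
Definition sort_index T (i : nat) : nat :=
  let Ti := restrict T i in
  let k := (col_of T i).-1 in
  if k == 0 then i - col Ti 1 + 1 else col Ti k - col Ti k.+1 + 1.

Definition nrows_of_size T (i : nat) : nat := count (fun r => size r == i) T.

Definition nrows T : nat := size T.

(* A tableau with n boxes has at most n rows, each with at most n boxes, so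
   SYT(n) embeds in the finite type of bounded lists used here. *)
Definition rows (n : nat) (T : n.-bseq (n.-bseq 'I_n.+1)) : seq (seq nat) :=
  [seq [seq val a | a <- bseqval r] | r <- bseqval T].

Definition SYT (n : nat) : {set n.-bseq (n.-bseq 'I_n.+1)} :=
  [set T : n.-bseq (n.-bseq 'I_n.+1) | is_syt n (rows T)].

End Tableaux.

(* Main.v *)
Require Import Defs.
From mathcomp Require Import all_boot all_order all_fingroup all_algebra.
From mathcomp Require Import mpoly.
From mathcomp Require Import zify ring.

Import GRing.Theory.
Local Open Scope ring_scope.

(** Both families of polynomials come from one derivation, [der], the one with
    [der x = der y = x y].  Give the word [0 w 0] the product over its adjacent
    pairs of [x] (descent) or [y] (ascent or plateau).  Inserting a block of
    [m.+1] copies of a new largest letter in a gap turns the mark of that gap,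
    whichever it was, into [x y], up to a further factor [y ^ m] for the
    plateaus inside the block.  Summing over all gaps is thus the Leibniz rule:
    it applies [y ^ m * der] to the weight ([sum_insertions]).  Permutations
    grow by blocks of length 1 and Stirling permutations by blocks of length 2,
    because nothing may stand between the two copies of the largest letter.
    Hence [A_n = der^n y] for [n >= 1] ([eulerS]) and [C_n = (y der)^n y]
    ([euler2S]).

    Expand [(y der)^n y] with [c_k = der^k y].  Every monomial is a product of
    [n.+1] factors [c_k] whose indices sum to [n], that is, the row lengths of
    a Ferrers diagram with [n] boxes, padded with zeros to [n.+1] rows, where
    [c_0 = y] accounts for the power of [y] in the theorem.  Applying [y der]
    raises one index [k] by one and adds a new row of length 0; a given [k] can
    be chosen in as many ways as it occurs among the padded row lengths.  On
    tableaux this adds the entry [n.+1] to the lowest row of length [k], and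
    the number of choices is exactly the box sorting index of [n.+1] in the new
    tableau ([sort_index_grow_new]).  Since every standard Young tableau of size
    [n.+1] arises exactly once in this way ([mem_syts], [syts_uniq]), the
    theorem follows by induction on [n] ([sum_grow_weight]). *)

(** * Sums over finite types as sums over lists *)

(** The recursions below live on plain lists of words or of rows; this lemma
    moves the sums over permutations, tuples and bounded lists there. *)
Lemma big_inj_image (R : nmodType) (I : finType) (T : eqType) (A : {set I})
    (f : I -> T) (L : seq T) (G : T -> R) :
    injective f -> uniq L -> (forall i, (i \in A) = (f i \in L)) ->
    (forall t, t \in L -> exists i, f i = t) ->
  \sum_(i in A) G (f i) = \sum_(t <- L) G t.
Proof.
move=> f_inj uL AL surj; rewrite -big_enum -(big_map f predT).
apply/perm_big/uniq_perm => //; first by rewrite map_inj_uniq ?enum_uniq.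
move=> t; apply/mapP/idP => [[i] | tL].
  by rewrite mem_enum AL => fiL ->.
by have [i fi] := surj t tL; exists i; rewrite ?mem_enum ?AL fi.
Qed.

(** * The Eulerian derivation *)

Definition der (p : {mpoly int[2]}) : {mpoly int[2]} :=
  xvar * yvar * (mderiv ord0 p + mderiv ord_max p).

Lemma derD p q : der (p + q) = der p + der q.
Proof. by rewrite /der !mderivD; ring. Qed.

Lemma der0 : der 0 = 0.
Proof. by rewrite /der !mderiv0 addr0 mulr0. Qed.

Lemma derM p q : der (p * q) = der p * q + p * der q.
Proof. by rewrite /der !mderivM; ring. Qed.

Lemma derMn m p : der (m%:R * p) = m%:R * der p.
Proof. by rewrite !mulr_natl /der !mderivMn -mulrnDl mulrnAr. Qed.

Lemma der1 : der 1 = 0.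
Proof. by rewrite /der -mpolyC1 !mderivC addr0 mulr0. Qed.

Lemma der_sum (I : Type) (r : seq I) (F : I -> {mpoly int[2]}) :
  der (\sum_(i <- r) F i) = \sum_(i <- r) der (F i).
Proof. exact: (big_morph der derD der0). Qed.

Lemma mnm_subnn (n : nat) (k : 'X_{1..n}) : (k - k)%MM = 0%MM.
Proof. by apply/mnmP => i; rewrite mnmBE mnm0E subnn. Qed.

Lemma der_xvar : der xvar = xvar * yvar.
Proof. 
by rewrite /der !mderivX !mnmE /= scale0r mnm_subnn mpolyX0 scale1r addr0 mulr1.
Qed.

Lemma der_yvar : der yvar = xvar * yvar.
Proof. 
by rewrite /der !mderivX !mnmE /= scale0r mnm_subnn mpolyX0 scale1r add0r mulr1.
Qed.

Lemma der_prod (s : seq nat) (c : nat -> {mpoly int[2]}) :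
  der (\prod_(k <- s) c k) = \sum_(k <- s) der (c k) * \prod_(j <- rem k s) c j.
Proof.
elim: s => [|a s IHs]; first by rewrite !big_nil der1.
rewrite !big_cons derM IHs /= eqxx; congr (_ + _).
rewrite mulr_sumr; apply: eq_big_seq => k ks.
case: eqP => [-> //|_]; last by rewrite big_cons; ring.
by rewrite mulrCA (perm_big _ (perm_to_rem ks)) big_cons.
Qed.

(** * Weighted words and the insertion of a block of largest letters *)

Definition slot_mark (a b : nat) : {mpoly int[2]} :=
  if (b < a)%N then xvar else yvar.

Fixpoint slot_weight (a : nat) (w : seq nat) : {mpoly int[2]} :=
  if w is b :: w' then slot_mark a b * slot_weight b w' else 1.

Lemma des_cons2 a b w : des [:: a, b & w] = ((b < a) + des (b :: w))%N.
Proof. by rewrite /des /= big_nat_recl. Qed.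

Lemma des1 a : des [:: a] = 0%N.
Proof. by rewrite /des big_geq. Qed.

Lemma des_rcons w a b : des (rcons (rcons w a) b) = (des (rcons w a) + (b < a))%N.
Proof.
elim: w => [|c w IHw]; first by rewrite /des /= big_nat1 big_geq.
case: w IHw => [_|d w IHw]; last by rewrite !rcons_cons !des_cons2 -!rcons_cons IHw; lia.
by rewrite /= !des_cons2 !des1; lia.
Qed.

Lemma des_size a w : (des (a :: w) <= size w)%N.
Proof.
elim: w a => [|b w IHw] a; first by rewrite /des big_geq.
by rewrite des_cons2 /=; have := IHw b; lia.
Qed.

Lemma slot_weightE a w :
  slot_weight a w
  = xvar ^+ des (a :: w) * yvar ^+ (size w - des (a :: w)).
Proof.
elim: w a => [|b w IHw] a; first by rewrite /des big_geq //= expr0 mulr1.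
rewrite des_cons2 /= IHw /slot_mark; have := des_size b w.
case: ltnP => _ /= les; first by rewrite subSS exprS mulrA.
by rewrite add0n subSn // exprS; ring.
Qed.

(** The 0 put in front creates a non-descent, whose [y] is what makes the total
    degree [(size w).+1]; for the empty word the pair [0 0] plays that part. *)
Lemma slot_weight_rcons0 w :
  slot_weight 0 (rcons w 0%N)
  = xvar ^+ des (rcons w 0%N) * yvar ^+ ((size w).+1 - des (rcons w 0%N)).
Proof.
rewrite slot_weightE size_rcons.
suff -> : des (0%N :: rcons w 0%N) = des (rcons w 0%N) by [].
by case: w => [|a w]; rewrite ?des_cons2 // /= des_cons2; rewrite /des !big_geq.
Qed.

Fixpoint insertions (B w : seq nat) : seq (seq nat) :=
  (B ++ w) :: (if w is a :: w' then map (cons a) (insertions B w') else [::]).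

Lemma insertionsP B w v :
  reflect (exists v1 v2, v = v1 ++ B ++ v2 /\ w = v1 ++ v2)
          (v \in insertions B w).
Proof.
apply: (iffP idP) => [|[v1 [v2 [-> ->]]]]; last first.
  elim: v1 => [|a v1 IHv1] /=; last by rewrite inE map_f ?orbT.
  by case: v2 => [|a v2] /=; rewrite inE eqxx.
elim: w v => [|a w IHw] v /=.
  by rewrite inE => /eqP ->; exists [::], [::].
rewrite inE => /orP[/eqP -> | /mapP[u /IHw [v1 [v2 [-> ->]]] ->]].
  by exists [::], (a :: w).
by exists (a :: v1), v2.
Qed.

Lemma insertions_uniq m N w :
  N \notin w -> uniq (insertions (nseq m.+1 N) w).
Proof.
elim: w => [//|a w IHw]; rewrite inE negb_or => /andP[Na Nw].
rewrite cons_uniq map_inj_uniq ?IHw //; last by move=> ? ? [].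
by rewrite andbT; apply/mapP => -[u _ [eNa _]]; rewrite eNa eqxx in Na.
Qed.

Lemma slot_weight_block m N a b w : (a < N)%N -> (b < N)%N ->
  slot_weight a (nseq m.+1 N ++ b :: w)
  = yvar ^+ m.+1 * xvar * slot_weight b w.
Proof.
move=> aN bN.
have H k : slot_weight N (nseq k N ++ b :: w) = yvar ^+ k * xvar * slot_weight b w.
  elim: k => [|k IHk] /=; first by rewrite /slot_mark bN expr0 mul1r.
  by rewrite IHk /slot_mark ltnn exprS !mulrA.
by rewrite /= H /slot_mark ltnNge (ltnW aN) /= exprS; ring.
Qed.

(** Each insertion destroys one mark and produces [y ^ m * x * y], whatever the
    mark was.  As [der] maps both marks to [x * y], the insertions match the
    terms of the Leibniz rule one by one. *)
Lemma sum_insertions m N a w : all (gtn N) (a :: w) ->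
  \sum_(v <- insertions (nseq m.+1 N) w) slot_weight a (rcons v 0%N)
  = yvar ^+ m * der (slot_weight a (rcons w 0%N)).
Proof.
have der_mark c d : der (slot_mark c d) = xvar * yvar.
  by rewrite /slot_mark; case: ifP; rewrite ?der_xvar ?der_yvar.
elim: w a => [|b w IHw] a /=.
  rewrite andbT => aN; rewrite big_seq1 cats0 -[N :: _]/(nseq m.+1 N) -cats1.
  rewrite slot_weight_block ?(leq_ltn_trans _ aN) //= derM der1 der_mark exprS.
  by ring.
case/and3P=> aN bN wN.
rewrite big_cons big_map /= -mulr_sumr IHw /= ?bN //.
rewrite -[rcons (nseq _ _ ++ _) _]/(rcons (nseq m N ++ (b :: w)) 0%N).
rewrite rcons_cat /= -[slot_mark a N * _]/(slot_weight a (nseq m.+1 N ++ b :: rcons w 0%N)).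
by rewrite slot_weight_block // derM der_mark exprS; ring.
Qed.

Lemma filter_insertion m N w v : N \notin w ->
  v \in insertions (nseq m N) w -> [seq a <- v | a != N] = w.
Proof.
move=> Nw /insertionsP[v1 [v2 [-> wE]]]; rewrite wE mem_cat negb_or in Nw *.
case/andP: Nw => N1 N2; rewrite !filter_cat.
have filter_id u : N \notin u -> [seq a <- u | a != N] = u.
  by move=> Nu; apply/all_filterP/allP => a au; apply: contraNneq Nu => <-.
by rewrite filter_nseq eqxx mul0n !filter_id.
Qed.

(** Erasing the new letter recovers the old word, so distinct pairs of a word and
    a gap give distinct new words. *)
Lemma sum_slot_weight_grow m N (L L' : seq (seq nat)) :
    (0 < N)%N -> uniq L -> uniq L' -> {in L, forall w, all (gtn N) w} ->
    (forall v, v \in L' <->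
       exists v1 v2, v = v1 ++ nseq m.+1 N ++ v2 /\ v1 ++ v2 \in L) ->
  \sum_(v <- L') slot_weight 0 (rcons v 0%N)
  = yvar ^+ m * der (\sum_(w <- L) slot_weight 0 (rcons w 0%N)).
Proof.
move=> N0 uL uL' ltN memL'.
have NL w : w \in L -> N \notin w.
  by move=> /ltN /allP wN; apply/negP => /wN; rewrite /= ltnn.
set J := [seq v | w <- L, v <- insertions (nseq m.+1 N) w].
have pJ : perm_eq L' J.
  apply: uniq_perm => //.
    apply: allpairs_uniq_dep => // [w /NL /insertions_uniq //|].
    move=> [w v] [w' v'] /allpairsPdep[x [y [xL yx [ew ev]]]].
    move=> /allpairsPdep[x' [y' [xL' yx' [ew' ev']]]] /= evv.
    have eqw : w = w'.
      rewrite ew ew' -(filter_insertion _ _ _ _ (NL _ xL) yx).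
      by rewrite -(filter_insertion _ _ _ _ (NL _ xL') yx') -ev -ev' evv.
    by rewrite eqw evv.
  move=> v; apply/idP/allpairsPdep.
    case/memL' => v1 [v2 [-> wL]]; exists (v1 ++ v2), (v1 ++ nseq m.+1 N ++ v2).
    by split=> //; apply/insertionsP; exists v1, v2.
  case=> w [u [wL /insertionsP[v1 [v2 [eu ew]]] ->]].
  by apply/memL'; exists v1, v2; rewrite -ew.
rewrite (perm_big _ pJ) /J big_allpairs_dep der_sum mulr_sumr.
apply: eq_big_seq => w wL; apply: sum_insertions.
by rewrite /= N0; apply: ltN.
Qed.

(** * Eulerian polynomials *)

Definition euler_words n := permutations (iota 1 n).
(** This is [A_n] for [n >= 1], but [y] for [n = 0], while [A_0] would be [x]:
    with this value the recursion [eulerS] starts at 0, and rows of length 0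
    contribute the powers of [y]. *)
Definition euler n := \sum_(w <- euler_words n) slot_weight 0 (rcons w 0%N).

Lemma iota1S n : iota 1 n.+1 = rcons (iota 1 n) n.+1.
Proof. by rewrite -[X in iota 1 X]addn1 iotaD cats1 add1n. Qed.

Lemma all_iota1 n s : {subset s <= iota 1 n} -> all (gtn n.+1) s.
Proof. by move=> sub; apply/allP => a /sub; rewrite mem_iota add1n => /andP[]. Qed.

Lemma euler0 : euler 0 = yvar.
Proof. by rewrite /euler /euler_words /= big_seq1 /= /slot_mark ltnn mulr1. Qed.

Lemma eulerS n : euler n.+1 = der (euler n).
Proof.
rewrite /euler (@sum_slot_weight_grow 0 n.+1 (euler_words n)).
- by rewrite expr0 mul1r.
- by [].
- exact: permutations_uniq.
- exact: permutations_uniq.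
- move=> w; rewrite mem_permutations => /perm_mem eqw.
  by apply: all_iota1 => a; rewrite eqw.
have perm_mid v1 v2 : perm_eq (v1 ++ n.+1 :: v2) (iota 1 n.+1)
                      = perm_eq (v1 ++ v2) (iota 1 n).
  by rewrite iota1S (perm_catCA v1 [:: _]) perm_sym perm_rcons perm_cons perm_sym.
move=> v; rewrite mem_permutations; split=> [pv|[v1 [v2 [-> ]]]]; last first.
  by rewrite mem_permutations perm_mid.
have : n.+1 \in v by rewrite (perm_mem pv) mem_iota; lia.
move=> /path.splitPr vE; case: vE pv => v1 v2 pv.
by exists v1, v2; rewrite mem_permutations -perm_mid.
Qed.

(** A positive last letter makes the final 0 one more descent, which is the extra
    [x] in the definition of the Eulerian polynomial. *)
Lemma euler_eulerian n : (0 < n)%N -> eulerian n = euler n.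
Proof.
case: n => // n _.
pose G (w : seq nat) := xvar ^+ (des w).+1 * yvar ^+ (n.+1 - des w).
transitivity (\sum_(s in [set: 'S_n.+1]) G (perm_word s)).
  by apply: eq_bigl => s; rewrite inE.
rewrite (@big_inj_image _ _ _ _ _ (euler_words n.+1)).
- apply: eq_big_seq => w; rewrite mem_permutations => pw.
  rewrite slot_weight_rcons0 /G (perm_size pw) size_iota.
  suff -> : des (rcons w 0%N) = (des w).+1 by rewrite subSS.
  have /= allw : all (ltn 0) w 
    by rewrite (perm_all _ pw); apply/allP => a; rewrite mem_iota => /andP[].
  case/lastP: w allw pw => [_ /perm_size //|w a].
  by rewrite all_rcons => /andP[/= a0 _] _; rewrite des_rcons a0 addn1.
- move=> s t /eq_in_map est; apply/permP => i; apply: val_inj.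
  by have := est i; rewrite mem_enum => /(_ isT)[].
- exact: permutations_uniq.
- move=> s; rewrite inE mem_permutations; apply/esym/uniq_perm.
  + rewrite map_inj_uniq ?enum_uniq // => i j [] /val_inj; exact: perm_inj.
  + exact: iota_uniq.
  + move=> a; rewrite mem_iota add1n.
    apply/mapP/idP => [[i _ ->]|/andP[a0 an]]; first exact: (ltn_ord (s i)).
    have lea : (a.-1 < n.+1)%N by lia.
    exists ((s^-1)%g (Ordinal lea)); rewrite ?mem_enum // permKV /=; lia.
- move=> w; rewrite mem_permutations => pw.
  have szw : size w = n.+1 by rewrite (perm_size pw) size_iota.
  have nthw (i : 'I_n.+1) : (0 < nth 0%N w i <= n.+1)%N.
    have : nth 0%N w i \in w by rewrite mem_nth ?szw.
    by rewrite (perm_mem pw) mem_iota; lia.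
  pose f (i : 'I_n.+1) : 'I_n.+1 := inord (nth 0%N w i).-1.
  have fE i : (f i).+1 = nth 0%N w i by rewrite inordK; have := nthw i; lia.
  have f_inj : injective f.
    move=> i j eqf; apply/val_inj/eqP.
    rewrite /= -(@nth_uniq _ 0%N w) ?szw // -?fE ?eqf //.
    by rewrite (perm_uniq pw) iota_uniq.
  exists (perm f_inj).
  transitivity (map (nth 0%N w) (map val (enum 'I_n.+1))).
    by rewrite -map_comp; apply: eq_map => i; rewrite /= permE fE.
  by rewrite val_enum_ord -szw map_nth_iota0 // take_size.
Qed.

(** * Stirling permutations *)

(** With subsequences in place of positions, erasing letters clearly preserves
    the condition. *)
Definition stirling (w : seq nat) : bool :=
  all (fun a => all (fun b => subseq [:: a; b; a] w ==> (a <= b)%N) w) w.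

Lemma stirlingP w :
  reflect (forall a b, subseq [:: a; b; a] w -> (a <= b)%N) (stirling w).
Proof.
apply: (iffP allP) => [st a b sub|st a aw]; last first.
  by apply/allP => b bw; apply/implyP; apply: st.
have aux := mem_subseq sub.
have [aw bw] : a \in w /\ b \in w by rewrite !aux // !inE eqxx ?orbT.
by have /allP/(_ b bw)/implyP := st a aw; apply.
Qed.

Definition stirling_words n :=
  [seq w <- permutations (iota 1 n ++ iota 1 n) | stirling w].
Definition euler2 n := \sum_(w <- stirling_words n) slot_weight 0 (rcons w 0%N).

Lemma euler2_0 : euler2 0 = yvar.
Proof. by rewrite /euler2 /stirling_words /= big_seq1 /= /slot_mark ltnn mulr1. Qed.

Lemma subseq_cons_notin (a : nat) s v1 v2 : a \notin v1 ->
  subseq (a :: s) (v1 ++ v2) = subseq (a :: s) v2.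
Proof.
elim: v1 => [//|b v1 IHv1]; rewrite inE negb_or => /andP[ab /IHv1 {}IHv1].
by rewrite /= (negPf ab) -IHv1.
Qed.

(** A forbidden pattern [a b a] cannot use an adjacent pair of largest letters:
    as [b] they are harmless, and as the outer letters they have no room for
    anything in between. *)
Lemma stirling_insertion N v1 v2 : all (gtn N) (v1 ++ v2) ->
  stirling (v1 ++ [:: N; N] ++ v2) = stirling (v1 ++ v2).
Proof.
move=> ltN.
have [N1 N2] : N \notin v1 /\ N \notin v2.
  by apply/norP; rewrite -mem_cat; apply/negP => /(allP ltN); rewrite /= ltnn.
apply/stirlingP/stirlingP => st a b sub.
  apply: st; apply: subseq_trans sub _.
  by rewrite cat_subseq //; apply: suffix_subseq.
have ab : {subset [:: a; b; a] <= v1 ++ [:: N; N] ++ v2} by exact: mem_subseq.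
have leN c : c \in [:: a; b; a] -> (c <= N)%N.
  move=> /ab; rewrite mem_cat /= !inE (orbA (c == N)) orbb orbCA -mem_cat.
  by case/orP => [/eqP -> // | /(allP ltN) /ltnW].
have [<-|bN] := eqVneq N b; first by rewrite leN // inE eqxx.
have [eNa|aN] := eqVneq N a; last first.
  apply: st.
  have -> : v1 ++ v2 = [seq c <- v1 ++ [:: N; N] ++ v2 | N != c].
    rewrite !filter_cat /= eqxx /= -filter_cat; apply/esym/all_filterP.
    by apply: sub_all ltN => c /= /ltn_eqF; rewrite eq_sym => ->.
  by rewrite subseq_filter /= aN bN.
move: sub; rewrite -eNa subseq_cons_notin //= eqxx eq_sym (negPf bN).
move=> /(@mem_subseq _ _ _) /(_ N); rewrite !inE eqxx orbT => /(_ isT).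
by rewrite (negPf N2).
Qed.

(** The two copies of the largest letter are adjacent in a Stirling permutation,
    so it arises from a smaller one by inserting them as a block. *)
Lemma euler2S n : euler2 n.+1 = yvar * der (euler2 n).
Proof.
rewrite /euler2 (@sum_slot_weight_grow 1 n.+1 (stirling_words n)).
- by [].
- by [].
- by rewrite filter_uniq ?permutations_uniq.
- by rewrite filter_uniq ?permutations_uniq.
- move=> w; rewrite mem_filter mem_permutations => /andP[_ /perm_mem eqw].
  by apply: all_iota1 => a; rewrite eqw mem_cat orbb.
have perm_mid v1 v2 :
    perm_eq (v1 ++ [:: n.+1; n.+1] ++ v2) (iota 1 n.+1 ++ iota 1 n.+1)
    = perm_eq (v1 ++ v2) (iota 1 n ++ iota 1 n).
  apply/seq.permP/seq.permP => eqc p; have := eqc p;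
    by rewrite !iota1S -!cats1 !count_cat /=; lia.
have memE v1 v2 : (v1 ++ [:: n.+1; n.+1] ++ v2 \in stirling_words n.+1)
   = (v1 ++ v2 \in stirling_words n).
  rewrite !mem_filter !mem_permutations perm_mid.
  case pv: (perm_eq (v1 ++ v2) _); rewrite ?andbF // stirling_insertion //.
  by apply: all_iota1 => a; rewrite (perm_mem pv) mem_cat orbb.
move=> v; split=> [vL|[v1 [v2 [-> vL]]]]; last by rewrite memE.
suff [v1 [v2 ev]] : exists v1 v2, v = v1 ++ [:: n.+1; n.+1] ++ v2.
  by exists v1, v2; rewrite -memE -ev.
move: vL; rewrite mem_filter mem_permutations => /andP[/stirlingP st pv].
have cN : count_mem n.+1 v = 2%N.
  rewrite (seq.permP pv) count_cat !count_uniq_mem ?iota_uniq // mem_iota.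
  by rewrite add1n !ltnS leqnn.
have leN a : a \in v -> (a <= n.+1)%N.
  by rewrite (perm_mem pv) mem_cat orbb mem_iota add1n ltnS => /andP[].
have Nv : n.+1 \in v by rewrite -has_pred1 has_count cN.
have [w1 [w2 [w3 ev]]] : exists w1 w2 w3, v = w1 ++ n.+1 :: w2 ++ n.+1 :: w3.
  case/path.splitPr: Nv cN => v1 u; rewrite count_cat /= eqxx => cN.
  have [Nu|Nu] := boolP (n.+1 \in u).
    by case/path.splitPr: Nu => w2 w3; exists v1, w2, w3.
  have Nv1 : n.+1 \in v1.
    rewrite -has_pred1 has_count; move: cN; rewrite (count_memPn Nu).
    by case: (count_mem _ _).
  by case/path.splitPr: Nv1 => w1 w2; exists w1, w2, u; rewrite -catA.
(* A letter between the two copies would be at least [n.+1], a third copy. *)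
exists w1, w3; rewrite ev; case: w2 ev => // b w2 ev.
have bN : b == n.+1.
  rewrite eqn_leq leN /=; last by rewrite ev mem_cat !inE eqxx !orbT.
  apply: st; rewrite ev; apply: subseq_trans (suffix_subseq _ _).
  by rewrite /= !eqxx sub1seq mem_cat inE eqxx orbT.
by move: cN; rewrite ev count_cat /= eqxx bN count_cat /= eqxx; lia.
Qed.

(** The condition on three positions and the one on subsequences agree, since
    subsequences of length 3 are the images of increasing triples of positions. *)
Lemma eulerian2_euler2 n : eulerian2 n = euler2 n.
Proof.
pose f (t : (2 * n).-tuple 'I_n.+1) := [seq val a | a <- t].
pose G (w : seq nat) :=
   xvar ^+ des (rcons w 0%N) * yvar ^+ ((2 * n).+1 - des (rcons w 0%N)).
transitivity (\sum_(t in stirling_perms n) G (f t)); first by [].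
rewrite (@big_inj_image _ _ _ _ _ (stirling_words n)).
- apply: eq_big_seq => w; rewrite mem_filter mem_permutations => /andP[_ pw].
  rewrite slot_weight_rcons0 /G (perm_size pw) size_cat !size_iota.
  by rewrite mul2n addnn.
- by move=> s t /(inj_map val_inj) /val_inj.
- by rewrite filter_uniq ?permutations_uniq.
- move=> t; rewrite inE mem_filter mem_permutations andbC; congr (_ && _).
  have szf : size (f t) = (2 * n)%N by rewrite size_map size_tuple.
  have nthf (i : 'I_(2 * n)) : nth 0%N (f t) i = tnth t i.
    by rewrite (nth_map ord0) ?size_tuple // -tnth_nth.
  apply/forallP/stirlingP => [st a b|st i].
    have -> : f t = map (nth 0%N (f t)) (iota 0 (2 * n)).
      by rewrite -szf map_nth_iota0 // take_size.
    case/subseqP => m _; rewrite -map_mask => eabc.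
    have := sorted_mask ltn_trans m (iota_ltn_sorted 0 (2 * n)).
    have : {subset mask m (iota 0 (2 * n)) <= iota 0 (2 * n)}.
      by move=> l; apply: mem_mask.
    case: (mask m _) eabc => [|i [|j [|k [|]]]] // [ea eb ec] inm.
    rewrite /= andbT => /andP[ij jk].
    have ltm l : l \in [:: i; j; k] -> (l < 2 * n)%N.
      by move=> /inm; rewrite mem_iota => /andP[].
    have [hi hj hk] : [/\ (i < 2 * n), (j < 2 * n) & (k < 2 * n)]%N.
      by rewrite !ltm // !inE eqxx ?orbT.
    have /forallP/(_ (Ordinal hj))/forallP/(_ (Ordinal hk)) := st (Ordinal hi).
    by rewrite /= ij jk /= -val_eqE /= -!nthf /= -ea -ec eqxx /= eb.
  apply/forallP => j; apply/forallP => k; apply/implyP => /and3P[ij jk /eqP eik].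
  rewrite -!nthf; apply: st.
  rewrite {2}(nthf i) eik -nthf.
  have -> : [:: nth 0%N (f t) i; nth 0%N (f t) j; nth 0%N (f t) k]
    = map (nth 0%N (f t)) [:: val i; val j; val k] by [].
  have {2}-> : f t = map (nth 0%N (f t)) (iota 0 (2 * n)).
    by rewrite -szf map_nth_iota0 // take_size.
  apply/map_subseq/subseq_uniqP; rewrite ?iota_uniq //.
  apply: (irr_sorted_eq ltn_trans ltnn); first by rewrite /= ij jk.
    exact: sorted_filter ltn_trans _ _ (iota_ltn_sorted 0 (2 * n)).
  move=> l; rewrite mem_filter mem_iota add0n andb_idr // !inE.
  by case/or3P => /eqP ->; rewrite /= ltn_ord.
- move=> w; rewrite mem_filter mem_permutations => /andP[_ pw].
  have szw : size w = (2 * n)%N.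
    by rewrite (perm_size pw) size_cat !size_iota mul2n addnn.
  have szm : size (map (@inord n) w) == (2 * n)%N by rewrite size_map szw.
  exists (Tuple szm); rewrite /f /= -map_comp.
  rewrite -[RHS]map_id; apply/eq_in_map => a aw /=; rewrite inordK //.
  by move: aw; rewrite (perm_mem pw) mem_cat orbb mem_iota add1n => /andP[].
Qed.

(** * Standard Young tableaux *)

(** The columns are increasing if and only if any two rows, adjacent or not, are
    related in this way.  This makes the conditions on a tableau local, hence
    easy to follow when one row is changed. *)
Definition row_below (r r' : seq nat) : bool :=
  (size r' <= size r)%N
  && all (fun j => (nth 0 r j < nth 0 r' j)%N) (iota 0 (size r')).

Definition tableau (T : seq (seq nat)) : bool :=
  [&& 0%N \notin shape T, all (sorted ltn) T & pairwise row_below T].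

Lemma row_belowP r r' :
  reflect ((size r' <= size r)%N /\
           forall j, (j < size r')%N -> (nth 0 r j < nth 0 r' j)%N)
          (row_below r r').
Proof.
apply: (iffP andP) => -[szr cmp]; split=> //.
  by move=> j jr; apply: (allP cmp); rewrite mem_iota.
by apply/allP => j; rewrite mem_iota => /cmp.
Qed.

Lemma pairwise_row_below n T : all (fun r => size r <= n)%N T ->
  sorted geq (shape T) && all (fun k => sorted ltn (column T k)) (iota 1 n)
  = pairwise row_below T.
Proof.
have geq_trans : transitive geq by move=> b a c /= ba cb; apply: leq_trans cb ba.
rewrite (sorted_pairwise geq_trans).
rewrite (eq_all (fun k => sorted_pairwise ltn_trans (column T k))).
elim: T => [_|r T IHT] /=; first by apply/allP.
case/andP=> rn Tn; rewrite -IHT // {IHT} /column /=.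
apply/idP/idP.
  case/andP=> /andP[/allP ler ->] /allP colT; apply/andP; split.
    apply/allP => r' r'T; apply/row_belowP; split.
      by apply: ler; rewrite map_f.
    move=> j jr'.
    have jr : (j < size r)%N by apply: leq_trans jr' _; apply: ler; rewrite map_f.
    have /colT : j.+1 \in iota 1 n by rewrite mem_iota; lia.
    rewrite /= jr => /andP[/allP H _]; apply: H.
    by apply/mapP; exists r' => //; rewrite mem_filter jr'.
  apply/allP => k /colT /=; case: ifP => //= _ /andP[_ //].
case/andP=> /allP below /andP[-> /allP colT]; rewrite andbT; apply/andP; split.
  by apply/allP => _ /mapP[r' /below /row_belowP[ler _] ->].
apply/allP => k kn; have {}colT := colT k kn.
case: ifP => //= kr; rewrite colT andbT; apply/allP => _ /mapP[r' + ->].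
rewrite mem_filter => /andP[kr' /below /row_belowP[_ cmp]]; apply: cmp.
by move: kn; rewrite mem_iota; lia.
Qed.

Lemma notin_shape0 (T : seq (seq nat)) : (0%N \notin shape T) = all (fun r => size r != 0%N) T.
Proof. by rewrite -has_pred1 -all_predC all_map. Qed.

Lemma leq_size_flatten (T : seq (seq nat)) r :
  r \in T -> (size r <= size (flatten T))%N.
Proof.
elim: T => [//|r' T IHT]; rewrite inE /= size_cat => /orP[/eqP ->|/IHT le].
  exact: leq_addr.
exact: leq_trans le (leq_addl _ _).
Qed.

Lemma is_sytE n T : is_syt n T = perm_eq (flatten T) (iota 1 n) && tableau T.
Proof.
rewrite /is_syt /tableau; case pT: (perm_eq _ _); last by rewrite !andbF.
rewrite -(pairwise_row_below n); last first.
  apply/allP => r /leq_size_flatten; by rewrite (perm_size pT) size_iota.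
by do !bool_congr.
Qed.

(** Among the rows of length [k] only the lowest can receive a box; with [k = 0],
    or more generally a length that does not occur, a new row is opened. *)
Fixpoint grow (N k : nat) (T : seq (seq nat)) : seq (seq nat) :=
  if T is r :: T' then
    if size r == k then rcons r N :: T' else r :: grow N k T'
  else [:: [:: N]].

Lemma flatten_grow N k T : perm_eq (flatten (grow N k T)) (N :: flatten T).
Proof.
elim: T => [//|r T IHT] /=; case: ifP => _ /=.
  by rewrite cat_rcons (perm_catCA r [:: N]).
by rewrite perm_sym -cat1s perm_catCA /= perm_cat2l perm_sym.
Qed.

Lemma all_grow (P : pred (seq nat)) N k T :
    all P T -> (forall r, r \in T -> size r = k -> P (rcons r N)) ->
    (k \notin shape T -> P [:: N]) ->
  all P (grow N k T).
Proof.
elim: T => [_ _ /= -> //|r T IHT] /= /andP[Pr PT] Pgrow Pnew.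
case: eqP => [rk | /eqP rk] /=; first by rewrite Pgrow ?inE ?eqxx.
rewrite Pr IHT // => [r' r'T | kT]; first by apply: Pgrow; rewrite inE r'T orbT.
by apply: Pnew; rewrite inE negb_or eq_sym rk.
Qed.

Lemma all_ungrow (P : pred (seq nat)) N k T :
    (forall r, P (rcons r N) -> P r) -> all P (grow N k T) -> all P T.
Proof.
move=> Prc; elim: T => [//|r T IHT] /=; case: ifP => _ /= /andP[] // Pr.
- by rewrite (Prc _ Pr).
- by rewrite Pr.
Qed.

Definition corner k (T : seq (seq nat)) : bool := (k == 0%N) || (k \in shape T).

Lemma shape_grow_new N k T :
  k \notin shape T -> shape (grow N k T) = rcons (shape T) 1.
Proof.
elim: T => [//|r T IHT] /=; rewrite inE negb_or eq_sym => /andP[/negPf -> kT].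
by rewrite /= IHT.
Qed.

Lemma shape_grow_old N k T : k \in shape T ->
  perm_eq (k :: shape (grow N k T)) (k.+1 :: shape T).
Proof.
elim: T => [//|r T IHT] /=; rewrite inE eq_sym.
case: eqP => [rk _|_ /IHT /seq.permP eqT] /=; apply/seq.permP => p.
  by rewrite /= size_rcons rk addnCA.
by have /= := eqT p; lia.
Qed.

Lemma mem_shape_grow N k T : corner k T -> k.+1 \in shape (grow N k T).
Proof.
have [kT _|kT] := boolP (k \in shape T).
  have : k.+1 \in k :: shape (grow N k T).
    by rewrite (perm_mem (shape_grow_old N k T kT)) inE eqxx.
  by rewrite inE gtn_eqF.
rewrite /corner (negPf kT) orbF => /eqP k0.
by rewrite shape_grow_new // k0 mem_rcons inE eqxx.
Qed.

Lemma row_below_rcons r r' N : row_below r r' -> row_below (rcons r N) r'.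
Proof.
case/row_belowP => ler cmp; apply/row_belowP; rewrite size_rcons; split; first exact: leqW.
by move=> j jr'; rewrite nth_rcons (leq_trans jr' ler) cmp.
Qed.

Lemma row_below_unrcons r r' N : row_below r (rcons r' N) -> row_below r r'.
Proof.
case/row_belowP; rewrite size_rcons => ler cmp; apply/row_belowP; split; first exact: ltnW.
by move=> j jr'; have := cmp j (leqW jr'); rewrite nth_rcons jr'.
Qed.

(** The rows below the first row of length [k] are strictly longer than [k], so
    the new box rests on an old one, whose entry is smaller than [N]. *)
Lemma tableau_grow N k T : tableau T -> all (gtn N) (flatten T) ->
  corner k T -> tableau (grow N k T).
Proof.
case/and3P=> T0 rowT belowT /allP ltNT kT.
have ltN r : r \in T -> all (gtn N) r.
  by move=> rT; apply/allP => a ar; apply: ltNT; apply/flattenP; exists r.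
apply/and3P; split.
- move: T0; rewrite !notin_shape0 => T0; apply: all_grow => // r _ _.
  by rewrite size_rcons.
- apply: all_grow => // r rT _; have /allP/(_ r rT) := rowT.
  have /allP : all (gtn N) r by apply: ltN.
  case: r {rT} => //= a r rN; rewrite rcons_path => -> /=.
  by apply: rN; rewrite mem_last.
move: T0 belowT ltN kT; rewrite /corner {rowT ltNT}; elim: T => [//|r T IHT] /=.
rewrite inE negb_or => /andP[r0 T0] /andP[belowr belowT] ltN.
case: (size r =P k) => [rk _|/eqP rk kT] /=.
  by rewrite belowT andbT; apply: sub_all belowr => r'; apply: row_below_rcons.
have {}kT : (k == 0%N) || (k \in shape T).
  by move: kT; rewrite inE (eq_sym k (size r)) (negPf rk).
rewrite IHT // ?andbT => [|r' r'T]; last by apply: ltN; rewrite inE r'T orbT.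
have rowN : all (gtn N) r by apply: ltN; rewrite inE eqxx.
apply: all_grow => // [r' r'T r'k|kT'].
  have /row_belowP[ler cmp] := allP belowr r' r'T.
  have ltr : (k < size r)%N by rewrite ltn_neqAle -r'k ler r'k eq_sym rk.
  apply/row_belowP; rewrite size_rcons r'k; split=> // j; rewrite ltnS => jk.
  rewrite nth_rcons r'k; case: (ltnP j k) => [jk'|kj]; first by rewrite cmp ?r'k.
  have -> : j = k by lia.
  by rewrite eqxx; apply: (allP rowN); rewrite mem_nth.
apply/row_belowP => /=; split=> [|[|j]] //; first by rewrite lt0n eq_sym.
by move=> _ /=; apply: (allP rowN); rewrite mem_nth // lt0n eq_sym.
Qed.

(** The largest entry [N] ends its row and has nothing above it; once it is
    removed, its row is the lowest of its new length, as all lower rows were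
    already at least as long as the row with [N]. *)
Lemma tableau_shrink N T' :
    tableau T' -> all (geq N) (flatten T') -> count_mem N (flatten T') = 1%N ->
  exists T k, [/\ T' = grow N k T, tableau T & corner k T].
Proof.
case/and3P=> T0 rowT belowT leN cN.
suff [T [k [eT kT belowT1 T10]]] : exists T k,
    [/\ T' = grow N k T, corner k T, pairwise row_below T & 0%N \notin shape T].
  exists T, k; split=> //; rewrite /tableau T10 belowT1 andbT /=.
  apply: all_ungrow (_ : all (sorted ltn) (grow N k T)); last by rewrite -eT.
  by move=> [//|a r] /=; rewrite rcons_path => /andP[].
elim: T' T0 rowT belowT leN cN => [//|r' T' IHT'] /=.
rewrite inE negb_or => /andP[r0 T0] /andP[rowr rowT] /andP[belowr belowT].
rewrite all_cat count_cat => /andP[leNr leNT] cN.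
have [Nr|Nr] := boolP (N \in r'); last first.
  rewrite (count_memPn Nr) in cN.
  have [T [k [eT kT belowT1 T10]]] := IHT' T0 rowT belowT leNT cN.
  have r'k : size r' == k = false.
    have /mapP[r rT' rk] : k.+1 \in shape T' by rewrite eT mem_shape_grow.
    have /row_belowP[ler _] := allP belowr r rT'.
    by rewrite -rk in ler; rewrite gtn_eqF.
  exists (r' :: T), k; split=> /=.
  - by rewrite r'k eT.
  - by move: kT; rewrite /corner /= inE => /orP[->|->]; rewrite ?orbT.
  - rewrite belowT1 andbT; move: belowr; rewrite eT; apply: all_ungrow.
    by move=> r; apply: row_below_unrcons.
  - by rewrite inE negb_or r0.
case/lastP: r' => [//|r a] in r0 rowr belowr leNr cN Nr *.
have {Nr} aN : a = N.
  apply/eqP; rewrite eq_sym; apply: contraTT Nr => Na.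
  rewrite mem_rcons inE negb_or Na; apply/negP => Nr.
  move: rowr; rewrite (sorted_pairwise ltn_trans) pairwise_rcons.
  case/andP => /allP/(_ N Nr) /= + _; rewrite ltnNge => /negP; apply.
  by apply: (allP leNr); rewrite mem_rcons inE eqxx.
rewrite {a}aN in r0 rowr belowr leNr cN *.
have belowr' r' : r' \in T' -> row_below r r'.
  move=> r'T; have /row_belowP[ler cmp] := allP belowr r' r'T.
  have ltr : (size r' <= size r)%N.
    rewrite leqNgt; apply/negP => ltr; have := cmp _ ltr.
    rewrite nth_rcons ltnn eqxx ltnNge => /negP; apply.
    by apply: (allP leNT); apply/flattenP; exists r'; rewrite ?mem_nth.
  apply/row_belowP; split=> // j jr'.
  by have := cmp j jr'; rewrite nth_rcons (leq_trans jr' ltr).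
have [r00|rn0] := eqVneq (size r) 0%N; last first.
  exists (r :: T'), (size r); split=> /=.
  - by rewrite eqxx.
  - by rewrite /corner /= inE eqxx orbT.
  - by rewrite belowT andbT; apply/allP.
  - by rewrite inE negb_or eq_sym rn0.
exists [::], 0%N; split=> //=; case: T' T0 belowr' {IHT' rowT belowr belowT leNT cN} => [|r' T'].
  by rewrite (size0nil r00).
rewrite inE negb_or => /andP[r'0 _] /(_ r'); rewrite inE eqxx => /(_ isT).
by case/row_belowP; rewrite r00 leqn0 eq_sym (negPf r'0).
Qed.

(** * Generating the standard Young tableaux *)

Definition row_lengths (n : nat) (T : seq (seq nat)) : seq nat :=
  shape T ++ nseq (n.+1 - size T) 0%N.

Lemma corner_row_lengths n k T : k \in row_lengths n T -> corner k T.
Proof.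
by rewrite mem_cat mem_nseq /corner orbC => /orP[/andP[_ ->]|->]; rewrite ?orbT.
Qed.

Lemma row_lengths_corner n k T :
  (size T <= n)%N -> corner k T -> k \in row_lengths n T.
Proof.
move=> sT; rewrite mem_cat mem_nseq /corner => /orP[->|-> //].
by rewrite subn_gt0 ltnS sT orbT.
Qed.

(** This is the effect of [y * der] on the indices of a monomial: [k] becomes
    [k.+1] and a factor of index 0 is added. *)
Lemma row_lengths_grow n N k T :
    (size T <= n)%N -> 0%N \notin shape T -> k \in row_lengths n T ->
  perm_eq (row_lengths n.+1 (grow N k T))
          [:: 0%N, k.+1 & rem k (row_lengths n T)].
Proof.
move=> sT T0 kT.
rewrite -(perm_cons k).
apply: (@perm_trans _ [:: 0%N, k.+1 & row_lengths n T]); last first.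
  apply/seq.permP => p; have /= := seq.permP (perm_to_rem kT) p; lia.
rewrite /row_lengths; have [kS|kS] := boolP (k \in shape T).
  have pS := shape_grow_old N k T kS.
  have sg : size (grow N k T) = size T.
    by have := perm_size pS; rewrite /= !size_map => -[].
  rewrite sg subSn 1?leqW //= -cat_cons.
  apply/seq.permP => p; have /= := seq.permP pS p.
  by rewrite !count_cat /=; lia.
have k0 : k = 0%N.
  by have := corner_row_lengths _ _ _ kT; rewrite /corner (negPf kS) orbF => /eqP.
rewrite -(size_map size (grow _ _ _)) -/(shape _) shape_grow_new // k0 size_rcons size_map.
rewrite subSS -cats1; apply/seq.permP => p.
by rewrite /= !count_cat /= addn0 (addnC (count p (shape T))) !addnA.
Qed.

Lemma count_leq_row_lengths n k T :
  (0 < k)%N -> Defs.col T k = count (leq k) (row_lengths n T).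
Proof.
move=> k0; rewrite /Defs.col /column size_map size_filter count_cat count_map count_nseq.
by rewrite leqn0 (gtn_eqF k0) addn0.
Qed.

Lemma count_leqS k s : count (leq k) s = (count_mem k s + count (leq k.+1) s)%N.
Proof.
elim: s => [//|a s IHs] /=; rewrite IHs leq_eqVlt (eq_sym a).
by rewrite addnACA; congr (_ + _)%N; case: eqP => [->|]; rewrite ?ltnn.
Qed.

Lemma restrict_grow N k T i : (i < N)%N -> restrict (grow N k T) i = restrict T i.
Proof.
move=> iN; have Ni : (N <= i)%N = false by rewrite leqNgt iN.
rewrite /restrict; elim: T => [|r T IHT] /=; first by rewrite Ni.
case: ifP => _ /=; last by rewrite IHT.
by rewrite filter_rcons Ni.
Qed.

Lemma restrict_id T i :
  0%N \notin shape T -> all (geq i) (flatten T) -> restrict T i = T.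
Proof.
rewrite /restrict; elim: T => [//|r T IHT] /=.
rewrite inE negb_or all_cat => /andP[r0 T0] /andP[/all_filterP /= -> Ti].
by rewrite -size_eq0 eq_sym r0 IHT.
Qed.

Lemma row_of_cons r T i : row_of (r :: T) i = if i \in r then r else row_of T i.
Proof. by rewrite /row_of /=; case: ifP. Qed.

Lemma col_of_grow_old N k T i : i != N -> col_of (grow N k T) i = col_of T i.
Proof.
move=> iN; rewrite /col_of; congr S; elim: T => [|r T IHT] /=.
  by rewrite row_of_cons inE (negPf iN).
case: ifP => _; last by rewrite !row_of_cons; case: ifP.
rewrite !row_of_cons mem_rcons inE (negPf iN) /=; case: ifP => // ir.
by rewrite -cats1 index_cat ir.
Qed.

Lemma col_of_grow_new N k T :
  N \notin flatten T -> corner k T -> col_of (grow N k T) N = k.+1.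
Proof.
have idx r : N \notin r -> index N (rcons r N) = size r.
  by move=> Nr; rewrite -cats1 index_cat (negPf Nr) /= eqxx addn0.
rewrite /corner /col_of => NT kT; congr S; elim: T NT kT => [|r T IHT] /=.
  by rewrite row_of_cons inE eqxx /= eqxx orbF => _ /eqP.
rewrite mem_cat negb_or inE => /andP[Nr NT].
case: (size r =P k) => [<- _|/eqP rk kT].
  by rewrite row_of_cons mem_rcons inE eqxx /= idx.
rewrite row_of_cons (negPf Nr) IHT //.
by move: kT; rewrite (eq_sym k (size r)) (negPf rk).
Qed.

Lemma syt_facts n T : is_syt n T ->
  [/\ 0%N \notin shape T, (size T <= n)%N, all (gtn n.+1) (flatten T)
    & tableau T].
Proof.
rewrite is_sytE => /andP[pT tT]; have /andP[T0 _] := tT; split=> //.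
  rewrite -(size_iota 1 n) -(perm_size pT); elim: T T0 {pT tT} => [//|r T IHT] /=.
  rewrite inE negb_or size_cat eq_sym => /andP[r0 /IHT le].
  by rewrite -add1n leq_add // lt0n.
by apply: all_iota1 => a; rewrite (perm_mem pT).
Qed.

Lemma sort_index_grow_old N k T i :
  (i < N)%N -> sort_index (grow N k T) i = sort_index T i.
Proof.
by move=> iN; rewrite /sort_index restrict_grow // col_of_grow_old // ltn_eqF.
Qed.

Lemma syt_grow n k T :
  is_syt n T -> corner k T -> is_syt n.+1 (grow n.+1 k T).
Proof.
move=> sytT kT; have [_ _ ltT tT] := syt_facts _ _ sytT.
move: sytT; rewrite !is_sytE => /andP[pT _]; rewrite tableau_grow // andbT.
rewrite (permPl (flatten_grow _ _ _)) iota1S perm_sym perm_rcons perm_cons.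
by rewrite perm_sym.
Qed.

(** The number of rows of length [k] is the difference of the lengths of columns
    [k] and [k.+1] before the box is added.  Adding it in column [k.+1] reduces
    this difference by one, which the [+ 1] in the box sorting index restores.
    For [k = 0] the padded number of rows [n.+1] stands for column 0. *)
Lemma sort_index_grow_new n k T : is_syt n T -> k \in row_lengths n T ->
  sort_index (grow n.+1 k T) n.+1 = count_mem k (row_lengths n T).
Proof.
move=> sytT kT; have [T0 sT ltT tT] := syt_facts _ _ sytT.
have cT := corner_row_lengths _ _ _ kT.
have [T0' sT' ltT' tT'] := syt_facts _ _ (syt_grow _ _ _ sytT cT).
have pg := row_lengths_grow n n.+1 k T sT T0 kT.
rewrite /sort_index restrict_id //.
rewrite col_of_grow_new // /=; last first.
  by apply/negP => /(allP ltT); rewrite /= ltnn.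
have ck := count_leqS k (row_lengths n T).
have m0 : (0 < count_mem k (row_lengths n T))%N by rewrite -has_count has_pred1.
case: eqP => [k0|/eqP k0].
  rewrite (count_leq_row_lengths n.+1) // (seq.permP pg) /= count_rem kT.
  have sz : count (leq 0) (row_lengths n T) = n.+1.
    by rewrite (eq_count (a2 := predT)) // count_predT size_cat size_map size_nseq; lia.
  move: ck m0; rewrite k0 sz /=; lia.
rewrite !(count_leq_row_lengths n.+1) ?lt0n // !(seq.permP pg) /= !count_rem kT /=.
rewrite leqn0 (negPf k0) !leqnn leqnSn ltnn /= ck.
by move: m0; move: (count_mem k _) (count (leq k.+1) _) => m c; lia.
Qed.

Fixpoint syts (n : nat) : seq (seq (seq nat)) :=
  if n is m.+1 then
    [seq grow m.+1 k T | T <- syts m, k <- undup (row_lengths m T)]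
  else [:: [::]].

Lemma syt_flatten n T : is_syt n T -> perm_eq (flatten T) (iota 1 n).
Proof. by rewrite is_sytE => /andP[]. Qed.

Lemma mem_syts n T : (T \in syts n) = is_syt n T.
Proof.
elim: n T => [|n IHn] T.
  rewrite is_sytE inE; apply/eqP/andP => [-> // | [pT /andP[T0 _]]].
  case: T pT T0 => [//|[//|a r] T] /perm_size //.
apply/allpairsPdep/idP => [[T1 [k [T1L kT1 ->]]]|sytT].
  rewrite mem_undup in kT1; apply: syt_grow; first by rewrite -IHn.
  exact: corner_row_lengths kT1.
have [T0 sT ltT tT] := syt_facts _ _ sytT.
have pT := syt_flatten _ _ sytT.
have cN : count_mem n.+1 (flatten T) = 1%N.
  rewrite (seq.permP pT) count_uniq_mem ?iota_uniq // mem_iota.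
  by rewrite add1n ltnS leqnn.
have [T1 [k [eT tT1 kT1]]] := tableau_shrink n.+1 T tT ltT cN.
have sytT1 : is_syt n T1.
  rewrite is_sytE tT1 andbT -(perm_cons n.+1).
  by rewrite -(permPl (flatten_grow _ k _)) -eT (permPl pT) iota1S perm_rcons.
exists T1, k; rewrite IHn mem_undup; split=> //.
by apply: row_lengths_corner => //; have [] := syt_facts _ _ sytT1.
Qed.

(** Restricting to the entries up to [n] recovers the smaller tableau, and the
    column of [n.+1] recovers the length of the row that was extended. *)
Lemma syts_uniq n : uniq (syts n).
Proof.
elim: n => [//|n IHn] /=; apply: allpairs_uniq_dep => //.
  by move=> T _; apply: undup_uniq.
move=> [T k] [T' k'] /allpairsPdep[S [l [SL lS [eS el]]]].
move=> /allpairsPdep[S' [l' [SL' lS' [eS' el']]]] /= eg.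
move: SL lS SL' lS'; rewrite -eS -el -eS' -el' !mem_syts !mem_undup.
move=> sytT kT sytT' kT'.
have [T0 _ ltT _] := syt_facts _ _ sytT.
have [T0' _ ltT' _] := syt_facts _ _ sytT'.
have notin U : all (gtn n.+1) (flatten U) -> n.+1 \notin flatten U.
  by move=> ltU; apply/negP => /(allP ltU); rewrite /= ltnn.
have eqT : T = T'.
  rewrite -(restrict_id T n) // -(restrict_id T' n) //.
  by rewrite -(restrict_grow n.+1 k) // eg restrict_grow.
have [eqk] : k.+1 = k'.+1.
  rewrite -(col_of_grow_new n.+1 k T) ?notin ?(corner_row_lengths _ _ _ kT) //.
  by rewrite eg col_of_grow_new ?notin ?(corner_row_lengths _ _ _ kT').
by rewrite eqT eqk.
Qed.

(** * The expansion *)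

Definition shape_weight n T : {mpoly int[2]} :=
  \prod_(k <- row_lengths n T) euler k.

Definition syt_weight n T : {mpoly int[2]} :=
  (\prod_(1 <= i < n.+1) sort_index T i)%:R * shape_weight n T.

Lemma big_undup_count (s : seq nat) (F : nat -> {mpoly int[2]}) :
  \sum_(k <- s) F k = \sum_(k <- undup s) (count_mem k s)%:R * F k.
Proof.
rewrite -big_undup_iterop_count; apply: eq_bigr => k _.
by rewrite mulr_natl /GRing.natmul.
Qed.

(** The Leibniz rule on the product of the [euler k]: equal factors give equal
    terms, and their number is the box sorting index of the new entry. *)
Lemma sum_grow_weight n T : is_syt n T ->
  \sum_(k <- undup (row_lengths n T)) syt_weight n.+1 (grow n.+1 k T)
  = yvar * der (syt_weight n T).
Proof.
move=> sytT; have [T0 sT _ _] := syt_facts _ _ sytT.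
rewrite /syt_weight derMn der_prod [X in _ * (_ * X)]big_undup_count mulrCA !mulr_sumr.
apply: eq_big_seq => k; rewrite mem_undup => kT.
rewrite big_nat_recr //= sort_index_grow_new // natrM.
rewrite (@eq_big_nat _ _ _ _ _ _ (sort_index T)); last first.
  by move=> i /andP[_ iN]; rewrite sort_index_grow_old.
rewrite /shape_weight (perm_big _ (row_lengths_grow _ n.+1 _ _ sT T0 kT)) /=.
by rewrite !big_cons euler0 eulerS; ring.
Qed.

Lemma euler2_syts n : euler2 n = \sum_(T <- syts n) syt_weight n T.
Proof.
elim: n => [|n IHn].
  rewrite euler2_0 big_seq1 /syt_weight big_geq // mul1r /shape_weight.
  by rewrite /row_lengths /= big_seq1 euler0.
rewrite euler2S IHn der_sum mulr_sumr /= big_allpairs_dep.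
by apply: eq_big_seq => T; rewrite mem_syts => /sum_grow_weight.
Qed.

Lemma prod_count_iota n (s : seq nat) (F : nat -> {mpoly int[2]}) :
  {subset s <= iota 1 n} ->
  \prod_(1 <= i < n.+1) F i ^+ count_mem i s = \prod_(k <- s) F k.
Proof.
elim: s => [_|a s IHs sub].
  by rewrite big_nil big1.
rewrite big_cons -IHs => [|b bs]; last by apply: sub; rewrite inE bs orbT.
have aI : a \in iota 1 n by apply: sub; rewrite inE eqxx.
under eq_bigr do rewrite /= exprD.
rewrite big_split /=; congr (_ * _).
rewrite /index_iota subSS subn0 (bigD1_seq a) ?iota_uniq //= eqxx expr1.
by rewrite big1 ?mulr1 // => i; rewrite eq_sym => /negPf ->.
Qed.

Lemma syt_weightE n T : is_syt n T ->
  syt_weight n T =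
  (\prod_(1 <= i < n.+1)
      ((sort_index T i)%:R * eulerian i ^+ nrows_of_size T i))
  * yvar ^+ (n.+1 - nrows T).
Proof.
move=> sytT; have [T0 sT _ _] := syt_facts _ _ sytT.
rewrite big_split /= /syt_weight natr_prod -mulrA; congr (_ * _).
rewrite /shape_weight big_cat /= big_nseq euler0 -Monoid.iteropE; congr (_ * _).
rewrite -(prod_count_iota n); last first.
  move=> _ /mapP[r rT ->]; rewrite mem_iota add1n ltnS.
  have := leq_size_flatten T r rT.
  rewrite (perm_size (syt_flatten _ _ sytT)) size_iota => ->.
  by rewrite andbT lt0n; apply: contraNneq T0 => <-; rewrite map_f.
rewrite big_nat [RHS]big_nat; apply: eq_bigr => i /andP[i0 _].
by rewrite euler_eulerian // /nrows_of_size count_map.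
Qed.

(** * The theorem *)

Lemma rows_inj n : injective (@rows n).
Proof.
move=> S T; rewrite /rows => eST; apply: val_inj => /=.
apply: inj_map eST => r s ers; apply: val_inj => /=.
exact: inj_map val_inj _ _ ers.
Qed.

Lemma rows_surj n T : is_syt n T -> exists S : n.-bseq (n.-bseq 'I_n.+1), rows S = T.
Proof.
move=> sytT; have [T0 sT ltT _] := syt_facts _ _ sytT.
have pT := syt_flatten _ _ sytT.
have lift_row r : r \in T -> exists s : n.-bseq 'I_n.+1, map val (bseqval s) = r.
  move=> rT; have sr : (size (map (@inord n) r) <= n)%N.
    rewrite size_map; have := leq_size_flatten T r rT.
    by rewrite (perm_size pT) size_iota.
  exists (Bseq sr); rewrite /= -map_comp -[RHS]map_id.
  apply/eq_in_map => a ar /=; rewrite inordK //.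
  by apply: (allP ltT); apply/flattenP; exists r.
have lift_rows U : {subset U <= T} -> exists s : seq (n.-bseq 'I_n.+1),
    [seq [seq val a | a <- bseqval r] | r <- s] = U.
  elim: U => [_|r U IHU sub]; first by exists [::].
  have [s <-] := lift_row r (sub r (mem_head r U)).
  have [|t <-] := IHU; first by move=> q qU; apply: sub; rewrite inE qU orbT.
  by exists (s :: t).
have [s es] := lift_rows T (fun r => id).
have ss : (size s <= n)%N by rewrite -es size_map in sT.
by exists (Bseq ss).
Qed.

Theorem theorem38 (n : nat) (hn : (1 <= n)%N) :
  eulerian2 n =
  \sum_(T in SYT n)
     (\prod_(1 <= i < n.+1)
        ((sort_index (rows T) i)%:R * eulerian i ^+ nrows_of_size (rows T) i))
     * yvar ^+ (n.+1 - nrows (rows T)).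
Proof.
rewrite eulerian2_euler2 euler2_syts.
rewrite -(@big_inj_image _ _ _ (SYT n) (@rows n)) //.
- by apply: eq_bigr => T; rewrite inE => /syt_weightE.
- exact: rows_inj.
- exact: syts_uniq.
- by move=> T; rewrite inE mem_syts.
- by move=> T; rewrite mem_syts => /rows_surj.
Qed.
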